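(* (In ZFC.) There exists a Hausdorff countably compact monothetic topological monoid which is a submonoid of a topological group (with the subspace topology) but is not a group.
   Context: A topological monoid is a monoid endowed with a topology for which multiplication is (jointly) continuous. A topological monoid $M$ is monothetic if $M=\overline{\{a^n:n\in\mathbb N\}}$ for some $a\in M$, where $\mathbb N=\{0,1,2,\dots\}$. A space is countably compact if every countable open cover has a finite subcover. *)

(* Defs.v *)
From HB Require Import structures.
From mathcomp Require Import all_boot.
From mathcomp Require Import all_classical topology.

Set Implicit Arguments.
Unset Strict Implicit.
Unset Printing Implicit Defensive.

Local Open Scope classical_set_scope.
Local Open Scope group_scope.

HB.structure Definition PreTopologicalMonoid :=
  {M of Topological M & monoid.Monoid M}.

HB.mixin Record PreTopologicalMonoid_isTopologicalMonoid M
    & PreTopologicalMonoid M := {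
  mulg_continuous : continuous (fun x : M * M => x.1 * x.2) }.

#[short(type="topologicalMonoidType")]
HB.structure Definition TopologicalMonoid :=
  {M of PreTopologicalMonoid M & PreTopologicalMonoid_isTopologicalMonoid M}.

HB.mixin Record TopologicalMonoid_isTopologicalGroup G
    & TopologicalMonoid G & monoid.Group G := {
  invg_continuous : continuous (fun x : G => x^-1) }.

#[short(type="topologicalGroupType")]
HB.structure Definition TopologicalGroup :=
  {G of TopologicalMonoid G & monoid.Group G
      & TopologicalMonoid_isTopologicalGroup G}.

Record submonoid (G : monoidType) := Submonoid {
  submonoid_set :> set G;
  submonoid1 : submonoid_set 1;
  submonoidM : forall x y,
    submonoid_set x -> submonoid_set y -> submonoid_set (x * y) }.

(* The carrier of a submonoid, with the induced operations and, by the
   library's instance on [set_type], the subspace topology. *)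
Definition submonoid_type (G : monoidType) (S : submonoid G) : Type :=
  set_type S.

Section SubmonoidMonoid.
Context (G : monoidType) (S : submonoid G).

HB.instance Definition _ := SubChoice.copy (submonoid_type S) (set_type S).

Fact submonoid_monoid_closed : monoid_closed (fun x : G => x \in (S : set G)).
Proof.
split=> [|x y]; first exact/mem_set/submonoid1.
rewrite /in_mem/= => /set_mem Sx /set_mem Sy.
exact/mem_set/submonoidM.
Qed.

HB.instance Definition _ :=
  SubChoice_isSubMonoid.Build G (fun x => x \in (S : set G))
    (submonoid_type S) submonoid_monoid_closed.

End SubmonoidMonoid.

Section SubmonoidTopology.
Context (G : topologicalMonoidType) (S : submonoid G).

HB.instance Definition _ := Topological.copy (submonoid_type S) (set_type S).

Fact submonoid_mulg_continuous :
  continuous (fun x : submonoid_type S * submonoid_type S => x.1 * x.2).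
Proof.
apply: (@continuous_comp_initial _ _ _ (set_val : S -> G)).
have cval : continuous (set_val : S -> G) by exact: initial_continuous.
suff -> : (set_val : S -> G) \o (fun x : submonoid_type S * submonoid_type S =>
    x.1 * x.2) = (fun x : G * G => x.1 * x.2) \o
    (fun x : submonoid_type S * submonoid_type S => (val x.1, val x.2)).
  move=> x; apply: continuous_comp; last exact: mulg_continuous.
  apply: cvg_pair.
    by apply: (continuous_comp (@cvg_fst _ _ _ _ _)); exact: cval.
  by apply: (continuous_comp (@cvg_snd _ _ _ _ _)); exact: cval.
by apply/funext => x; exact: (@monoid.valM _ _ (submonoid_type S)).
Qed.

HB.instance Definition _ :=
  PreTopologicalMonoid_isTopologicalMonoid.Build (submonoid_type S)
    submonoid_mulg_continuous.

End SubmonoidTopology.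

Definition countably_compact (T : topologicalType) :=
  forall C : set (set T), countable C -> (forall U, C U -> open U) ->
    \bigcup_(U in C) U = [set: T] ->
  exists D : set (set T),
    [/\ D `<=` C, finite_set D & \bigcup_(U in D) U = [set: T]].

Definition monothetic (M : topologicalMonoidType) :=
  exists a : M, closure (range (fun n : nat => a ^+ n)) = [set: M].

Definition is_group (M : monoidType) :=
  forall x : M, exists y : M, x * y = 1 /\ y * x = 1.

(* Main.v *)
Require Import Defs.
From HB Require Import structures.
From mathcomp Require Import all_boot all_order all_algebra.
From mathcomp Require Import cyclic separable cyclotomic complex.
From mathcomp Require Import zify ring.
From mathcomp Require Import all_classical all_reals topology normedtype.
From mathcomp Require Import Rstruct.

(** Terms are formal products of generators: one generator [Gen], and a
    generator [Lim f] for every sequence [f] of terms. They stand for the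
    elements of a free commutative monoid. A term [t] is evaluated in a
    power of the circle, as the family of all [phi t] for [phi] an
    admissible character, that is a homomorphism from terms to the circle
    such that [phi (Lim f)] is the limit of the [phi (f m)] along an
    ultrafilter attached to [f], whenever [f] belongs to a suitable class
    of sequences. Then [Lim f] evaluates to a cluster point of [f], which
    gives countable compactness; cutting with the closure of the powers of
    [Gen] gives a monothetic monoid; and [Gen] has no inverse as soon as,
    for each term [t], some admissible character is not [1] at the product
    of [Gen] and [t].

    Finding this character is the whole difficulty
    ([admissible_separates]). Only the countably many subterms of the
    given term matter, because on the other terms values can be defined
    recursively by the limits. On those subterms one needs the values at
    [f m] and [Lim f] to be close for enough indices [m]. By a
    quantitative Kronecker theorem ([kronecker_approximation]) finitely
    many such requirements can be met, with errors decreasing in [m], as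
    soon as the corresponding elements of the free abelian group satisfy
    no relation with small coefficients; compactness of the circle then
    deals with all of them together.

    The class of sequences on which limits are imposed consists of those
    without such relations; since the group is torsion-free, every
    sequence with infinitely many values has a subsequence of this kind
    ([dissociated_subsequence]). Different sequences may be related to one
    another, and this is where the choice of ultrafilters comes in. The
    integers are cut into finite blocks whose lengths grow so fast that
    [n] times the number of small coefficient vectors on the earlier
    blocks is less than the length of the [n]-th block. Terms are coded by
    sequences of integers, which yields an almost disjoint family of sets
    of blocks indexed by the terms; the ultrafilter of [Lim f] lives on
    the blocks of [Lim f] and contains every set that misses few elements
    of each of them. For countably many terms nearly all the blocks of
    each can be made disjoint from those of the others, and in each block
    all relations with the earlier ones disappear on deleting few indices
    ([dissociated_after_removal]): the remaining indices form a set in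
    each of the ultrafilters, and are free of small relations. *)

Set Implicit Arguments.
Unset Strict Implicit.
Unset Printing Implicit Defensive.
Import Order.TTheory GRing.Theory Num.Theory.
Local Open Scope classical_set_scope.
Local Open Scope ring_scope.

(** * Kronecker approximation without small relations *)

Section Kronecker.
Variable C : numClosedFieldType.

Lemma exists_prim_root n : (0 < n)%N -> exists z : C, n.-primitive_root z.
Proof.
move=> n_gt0; have [r] := closed_field_poly_normal ('X^n - 1 : {poly C}).
rewrite (monicP _) ?monicXnsubC // scale1r => Dp.
have rn1 : all n.-unity_root r.
  by apply/allP=> z; rewrite -root_prod_XsubC -Dp.
have sz_r : (n < (size r).+1)%N.
  by rewrite -(size_prod_XsubC r id) -Dp size_XnsubC.
have [|z] := hasP (has_prim_root n_gt0 rn1 _ sz_r); last by exists z.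
by rewrite -separable_prod_XsubC -Dp separable_Xn_sub_1 // pnatr_eq0 -lt0n.
Qed.

Lemma norm_prim_root Q (z : C) : Q.-primitive_root z -> `|z| = 1.
Proof.
move=> zP; apply/eqP; rewrite -(@pexpr_eq1 _ _ Q) ?normr_ge0 //.
  by rewrite -normrX (prim_expr_order zP) normr1.
exact: prim_order_gt0 zP.
Qed.

Lemma norm1_conj (z : C) : `|z| = 1 -> z^* = z^-1.
Proof. by move=> z1; rewrite invC_norm z1 expr1n invr1 mul1r. Qed.

Lemma norm1_neq0 (z : C) : `|z| = 1 -> z != 0.
Proof. by move=> z1; rewrite -normr_eq0 z1 oner_eq0. Qed.

Lemma norm1_exprz (z : C) (n : int) : `|z| = 1 -> `|z ^ n| = 1.
Proof.
move=> z1; case: n => n; rewrite ?NegzE -?exprnN /exprz ?normfV normrX z1 expr1n //.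
by rewrite invr1.
Qed.

Lemma sum_powers_prim_root Q (z : C) (n : int) : Q.-primitive_root z ->
  n != 0 -> (`|n| < Q)%N -> \sum_(y < Q) (z ^ n) ^+ y = 0.
Proof.
move=> zP n0 nQ.
have zu := norm1_neq0 (norm_prim_root zP).
have zn1 : z ^ n - 1 != 0.
  rewrite subr_eq0; apply: contra n0.
  have dvd (m : nat) : (m < Q)%N -> z ^+ m == 1 -> m = 0%N.
    rewrite -(prim_order_dvd zP); case: m => // m mQ.
    by move/(dvdn_leq (ltn0Sn _)); rewrite leqNgt mQ.
  case: n nQ => m /=; first by move=> mQ /(dvd _ mQ) ->.
  rewrite NegzE -exprnN => mQ.
  by rewrite invr_eq1 => /(dvd _ mQ).
apply: (mulfI zn1); rewrite mulr0 -subrX1.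
rewrite exprnP exprz_exp mulrC -exprz_exp -exprnP (prim_expr_order zP).
by rewrite exp1rz subrr.
Qed.

(** Averaging over the powers of a primitive [Q]-th root of unity replaces
    Haar measure on the circle: exponentials whose integer frequencies are
    distinct and closer than [Q] are orthogonal for it. *)
Lemma parseval (K : finType) (P : pred K) (n : K -> int) (a : K -> C) Q z :
    Q.-primitive_root z ->
    (forall k k', P k -> P k' -> k != k' ->
       n k != n k' /\ (`|(n k - n k')%R| < Q)%N) ->
  \sum_(y < Q) `|\sum_(k | P k) a k * (z ^ n k) ^+ y| ^+ 2 =
  Q%:R * \sum_(k | P k) `|a k| ^+ 2.
Proof.
move=> zP sepn.
have z1 := norm_prim_root zP; have zn0 := norm1_neq0 z1.
transitivity (\sum_(k | P k) \sum_(k' | P k')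
   (a k * (a k')^* * \sum_(y < Q) (z ^ (n k - n k')) ^+ y)).
  under eq_bigr => y _.
    rewrite normCK rmorph_sum /= big_distrlr /=.
    over.
  rewrite exchange_big /=; apply: eq_bigr => k Pk.
  rewrite exchange_big /=; apply: eq_bigr => k' Pk'.
  rewrite mulr_sumr; apply: eq_bigr => y _.
  rewrite rmorphM /= rmorphXn /= (norm1_conj (norm1_exprz (n k') z1)).
  by rewrite expfzDr // exprMn -invr_expz mulrACA.
rewrite mulr_sumr; apply: eq_bigr => k Pk.
rewrite (bigD1 k) //= [X in _ + X]big1 ?addr0.
  rewrite subrr expr0z; under eq_bigr do rewrite expr1n.
  by rewrite sumr_const card_ord -normCK mulrC.
move=> k' /andP[Pk' kk']; rewrite eq_sym in kk'.
have [nn nQ] := sepn _ _ Pk Pk' kk'.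
by rewrite (sum_powers_prim_root zP) ?mulr0 ?subr_eq0.
Qed.

(** A quantitative Kronecker theorem.  Weight the points [w] of a finite cyclic
    group by the product over [i] of the Fejer kernels
    [|1 + u + ... + u^(L i - 1)|^2], where [u = w ^ v i / tau i].  The absence
    of small relations among the [v i] makes the frequencies in the expanded
    product distinct, so by Parseval the total weight is [Q] times the product
    of the [L i].  Multiplying the [i]-th kernel by [|u - 1|^2] telescopes it
    into [|u^(L i) - 1|^2], whose mean is [2] instead of [L i].  Hence the
    weighted mean of the left-hand side of the conclusion is the sum assumed
    to be less than [1], and some [w] does at least as well as the mean. *)
Lemma kronecker_approximation (I : finType) (v : I -> int) (L : I -> nat)
    (lam tau : I -> C) :
    (forall i, `|tau i| = 1) -> (forall i, 0 <= lam i) ->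
    \sum_(i | (0 < L i)%N) 2 * lam i / (L i)%:R < 1 ->
    (forall c : I -> int, (forall i, (`|c i| <= L i)%N) ->
       \sum_i c i * v i = 0 -> forall i, c i = 0) ->
  exists2 w : C, `|w| = 1 &
    \sum_(i | (0 < L i)%N) lam i * `|w ^ v i - tau i| ^+ 2 < 1.
Proof.
move=> tau1 lam0 sumlam dissoc.
pose Kb := (\max_i L i).+1; pose J := 'I_Kb.
pose n (f : {ffun I -> J}) : int := \sum_i (f i)%:Z * v i.
pose Q := (\max_(p : {ffun I -> J} * {ffun I -> J}) `|(n p.1 - n p.2)%R|%N).+1.
have [z zP] := exists_prim_root (ltn0Sn _ : (0 < Q)%N).
have z1 := norm_prim_root zP; have zn0 := norm1_neq0 z1.
pose u i (y : nat) := (z ^ v i) ^+ y / tau i.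
(* Parseval for a product of sums of unimodular multiples of powers of [u]. *)
have key (Qp : I -> pred J) (b : I -> J -> C) :
    (forall i j, Qp i j -> (j <= L i)%N) -> (forall i j, `|b i j| = 1) ->
    \sum_(y < Q) `|\prod_i \sum_(j | Qp i j) b i j * u i y ^+ j| ^+ 2 =
    Q%:R * \prod_i (#|Qp i|)%:R.
  move=> QpL b1.
  pose a (f : {ffun I -> J}) := \prod_i (b i (f i) / tau i ^+ f i).
  have expand (y : nat) : \prod_i \sum_(j | Qp i j) b i j * u i y ^+ j =
      \sum_(f in family Qp) a f * (z ^ n f) ^+ y.
    rewrite (bigA_distr_big_dep Qp (fun i (j : J) => b i j * u i y ^+ j)).
    apply: eq_bigr => f _.
    rewrite /a /n (big_morph _ (fun i j => expfzDr i j zn0) (expr0z z)).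
    rewrite -prodrXl -big_split /=; apply: eq_bigr => i _.
    rewrite /u exprMn exprVn mulrA mulrAC; congr (_ * _ * _).
    by rewrite mulrC -exprz_exp -exprnP -!exprM mulnC.
  rewrite (eq_bigr (fun y : 'I_Q =>
      `|\sum_(f in family Qp) a f * (z ^ n f) ^+ y| ^+ 2)); last first.
    by move=> y _; rewrite -expand.
  have a1 f : `|a f| = 1.
    rewrite /a normr_prod big1 // => i _.
    by rewrite normrM b1 mul1r normfV normrX tau1 expr1n invr1.
  rewrite (parseval a zP) => [|f f' Pf Pf' ff'].
    have -> : \sum_(f in family Qp) `|a f| ^+ 2 = \sum_(f in family Qp) 1.
      by apply: eq_bigr => f _; rewrite a1 expr1n.
    have card_sum i : (#|Qp i|)%:R = \sum_(j | Qp i j) 1 :> C.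
      by rewrite -sum1_card natr_sum.
    under [in RHS]eq_bigr => i _ do rewrite card_sum.
    rewrite (bigA_distr_big_dep Qp (fun _ _ => 1)).
    by congr (_ * _); apply: eq_bigr => f _; rewrite big1.
  split; last first.
    by rewrite /Q ltnS (leq_bigmax (f, f')).
  apply: contra ff' => /eqP nff'; apply/eqP/ffunP => i; apply/val_inj/eqP.
  have /(_ _ _ i)/eqP := dissoc (fun i => (f i)%:Z - (f' i)%:Z).
  rewrite subr_eq0 eqz_nat; apply.
    move=> k; have := QpL _ _ (familyP Pf k); have := QpL _ _ (familyP Pf' k).
    lia.
  by rewrite -[RHS](subrr (n f)) {2}nff' /n -sumrB; apply: eq_bigr => k _; rewrite mulrBl.
have LK i : (L i < Kb)%N by rewrite ltnS leq_bigmax.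
(* When [L i = 0] the kernel is the constant [1], whence the maximum. *)
pose m i := maxn (L i) 1.
have mK i : (m i <= Kb)%N by rewrite geq_max (ltnW (LK i)).
pose Q0 i : pred J := fun j => (j < m i)%N.
have cardQ0 i : #|Q0 i| = m i.
  by rewrite -sum1_card -(big_ord_widen _ (fun=> 1%N)) // sum1_card card_ord.
pose F (y : 'I_Q) : C := `|\prod_i \sum_(j | Q0 i j) 1 * u i y ^+ j| ^+ 2.
pose p : C := Q%:R * \prod_i (m i)%:R.
have p0 : 0 < p.
  rewrite mulr_gt0 ?ltr0n // prodr_gt0 // => i _.
  by rewrite ltr0n /m leq_max orbT.
have sumF : \sum_y F y = p.
  rewrite /F key => [|i j|i j]; last by rewrite normr1.
    by congr (_ * _); apply: eq_bigr => i _; rewrite cardQ0.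
  by rewrite /Q0 /m; lia.
have sumFu i : (0 < L i)%N ->
    \sum_y F y * `|u i y - 1| ^+ 2 = p * (2 / (L i)%:R).
  move=> Li.
  pose Q1 i' : pred J :=
    if i' == i then pred_of_simpl (pred2 (inord 0 : J) (inord (L i))) else Q0 i'.
  pose b i' (j : J) : C := if (i' == i) && (j == 0 :> nat) then -1 else 1.
  have -> : \sum_y F y * `|u i y - 1| ^+ 2 =
      \sum_(y < Q) `|\prod_i' \sum_(j | Q1 i' j) b i' j * u i' y ^+ j| ^+ 2.
    apply: eq_bigr => y _; rewrite /F -exprMn -normrM; congr (`|_| ^+ _).
    rewrite (bigD1 i) //= [RHS](bigD1 i) //= mulrAC; congr (_ * _).
      rewrite /Q1 /b eqxx /=.
      have v0 : (inord 0 : J) = 0%N :> nat by rewrite inordK.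
      have vL : (inord (L i) : J) = L i :> nat by rewrite inordK.
      have neq : (inord (L i) : J) != inord 0 by rewrite -val_eqE /= v0 vL -lt0n.
      rewrite [RHS](bigD1 (inord 0)) ?inE ?eqxx //=.
      rewrite [X in _ = _ + X](bigD1 (inord (L i))) /= ?eqxx ?orbT ?neq //.
      rewrite [X in _ = _ + (_ + X)]big1 ?addr0; last first.
        by move=> j; case: (j == _); case: (j == _).
      rewrite v0 vL (gtn_eqF Li) expr0 mulr1 mul1r [RHS]addrC.
      rewrite subrX1 mulrC; congr (_ * _).
      rewrite /Q0 (big_ord_widen _ (fun j => u i y ^+ j) (ltnW (LK i))).
      by apply: eq_big => [j|j _]; rewrite ?mul1r // /m (maxn_idPl Li).
    apply: eq_bigr => i' ii'; rewrite /Q1 /b (negbTE ii').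
    by apply: eq_bigr.
  rewrite key; last first.
  - by move=> i' j; rewrite /b; case: ifP => _; rewrite ?normrN normr1.
  - move=> i' j; rewrite /Q1; case: eqP => [->|_]; last by rewrite /Q0 /m; lia.
    by rewrite !inE => /orP[] /eqP ->; rewrite inordK.
  rewrite /p (bigD1 i) //= [in RHS](bigD1 i) //= -!mulrA; congr (_ * _).
  have -> : #|Q1 i| = 2%N.
    rewrite /Q1 eqxx card2 -val_eqE /= !inordK //.
    by rewrite eq_sym -lt0n Li.
  rewrite {1}/m (maxn_idPl Li) mulrC [RHS]mulrCA [_ * (2 / _)]mulrCA.
  rewrite divff ?mulr1 ?pnatr_eq0 -?lt0n //.
  congr (_ * _); apply: eq_bigr => i' ii'.
  by rewrite /Q1 (negbTE ii') cardQ0.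
have F0 y : 0 <= F y by rewrite exprn_ge0 ?normr_ge0.
pose S y : C := \sum_(i | (0 < L i)%N) lam i * `|u i y - 1| ^+ 2.
have S0 y : 0 <= S y.
  by apply: sumr_ge0 => i _; rewrite mulr_ge0 // exprn_ge0.
have [y Sy1] : exists y : 'I_Q, S y < 1.
  apply/existsP; apply: contraT; rewrite negb_exists => /forallP S1.
  have : p <= \sum_y F y * S y.
    rewrite -sumF; apply: ler_sum => y _; rewrite ler_peMr // real_leNgt ?rpred1 //.
    exact: ger0_real.
  under eq_bigr => y _ do rewrite mulr_sumr.
  rewrite exchange_big /=.
  have -> : \sum_(i | (0 < L i)%N) \sum_y F y * (lam i * `|u i y - 1| ^+ 2) =
      p * \sum_(i | (0 < L i)%N) 2 * lam i / (L i)%:R.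
    rewrite mulr_sumr; apply: eq_bigr => i Li.
    under eq_bigr => y _ do rewrite mulrCA.
    by rewrite -mulr_sumr sumFu // mulrCA [lam i * _]mulrCA [2 * (_ * _)]mulrA.
  rewrite ler_pMr // => le1.
  by have := le_lt_trans le1 sumlam; rewrite ltxx.
exists (z ^+ y); first by rewrite normrX z1 expr1n.
suff <- : S y = \sum_(i | (0 < L i)%N) lam i * `|(z ^+ y) ^ v i - tau i| ^+ 2 by [].
apply: eq_bigr => i _; congr (_ * _ ^+ _).
have t0 := norm1_neq0 (tau1 i).
have -> : (z ^+ y) ^ v i - tau i = tau i * (u i y - 1).
  rewrite mulrBr mulr1 /u mulrCA divff // mulr1.
  by rewrite !exprnP !exprz_exp mulrC.
by rewrite normrM tau1 mul1r.
Qed.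
End Kronecker.

(** * Families of integer forms without small relations *)

(** The forms [u m] satisfy no nontrivial finite relation whose [m]-th
    coefficient is at most [L m]; with [L m = 0] the form [u m] is left out. *)
Definition dissociated (H : Type) (L : nat -> nat) (u : nat -> H -> int) :=
  forall (c : nat -> int) N, (forall m, `|c m| <= L m)%N ->
    (forall h, \sum_(m < N) c m * u m h = 0) ->
    forall m, (m < N)%N -> c m = 0.

Section Subsequences.
Variables (H : Type) (L : nat -> nat) (u : nat -> H -> int).

(** Coefficient vectors with entries between [- B] and [B], encoded as
    functions into a finite type so that they can be counted. *)
Definition decode (B k : nat) (d : {ffun 'I_k -> 'I_(2 * B).+1}) (m : nat) : int :=
  if insub m is Some i then (d i)%:Z - B%:Z else 0.

Lemma decode_surj B k (c : nat -> int) :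
  (forall m, (m < k)%N -> (`|c m| <= B)%N) ->
  exists d : {ffun 'I_k -> 'I_(2 * B).+1},
    forall m, (m < k)%N -> decode d m = c m.
Proof.
move=> cB; exists [ffun i : 'I_k => inord (absz (c i + B%:Z))] => m mk.
rewrite /decode insubT ffunE /= inordK; first by have := cB m mk; lia.
by have := cB m mk; lia.
Qed.

(** A bounded relation with a nonzero coefficient on the last form determines
    that form, and there are finitely many coefficient vectors. *)
Lemma finite_dependent (s : seq nat) (B : nat) :
  (forall n, finite_set [set m | u m = u n]) ->
  finite_set [set n | exists (c0 : int) (c : nat -> int),
    [/\ c0 != 0, (`|c0| <= B)%N, (forall i, (i < size s)%N -> (`|c i| <= B)%N) &
     forall h, c0 * u n h + \sum_(i < size s) c i * u (nth 0%N s i) h = 0]].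
Proof.
move=> finu; set k := size s.
pose T := {ffun 'I_k.+1 -> 'I_(2 * B).+1}.
pose bad (d : T) := [set n | decode d k != 0 /\ forall h,
   decode d k * u n h + \sum_(i < k) decode d i * u (nth 0%N s i) h = 0].
apply: (@sub_finite_set _ _ (\bigcup_(d in [set: T]) bad d)).
  move=> n [c0 [c [c00 c0B cB rel]]].
  have [|d dE] := @decode_surj B k.+1 (fun m => if m == k then c0 else c m).
    move=> m mk; case: eqP => // /eqP mnk; apply: cB.
    by rewrite ltn_neqAle mnk -ltnS.
  exists d => //; rewrite /bad /= dE // eqxx; split=> // h.
  rewrite -[RHS](rel h); congr (_ + _); apply: eq_bigr => i _.
  by rewrite dE ?(ltn_eqF (ltn_ord i)) // ltnS ltnW.
apply: bigcup_finite; first exact: finite_finset.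
move=> d _; have [->|/set0P[n [nz reln]]] := eqVneq (bad d) set0.
  exact: finite_set0.
apply: (sub_finite_set _ (finu n)) => m [_ relm] /=.
apply/funext => h; apply: (mulfI nz).
by apply: (addIr (\sum_(i < k) decode d i * u (nth 0%N s i) h)); rewrite relm reln.
Qed.

(** Each new index is taken outside the finite set of those that would create
    a bounded relation with the indices already chosen. *)
Lemma dissociated_subsequence :
  (forall n, finite_set [set m | u m = u n]) ->
  exists2 g : nat -> nat, (forall k, (g k < g k.+1)%N) & dissociated L (u \o g).
Proof.
move=> finu.
pose B (s : seq nat) := (\max_(i < (size s).+1) L i)%N.
pose bad s := [set n | exists (c0 : int) (c : nat -> int),
    [/\ c0 != 0, (`|c0| <= B s)%N, (forall i, (i < size s)%N -> (`|c i| <= B s)%N) &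
     forall h, c0 * u n h + \sum_(i < size s) c i * u (nth 0%N s i) h = 0]].
have /choice[F FP] s : exists n, ~ bad s n /\ forall m, m \in s -> (m < n)%N.
  have /finite_seqP[s' s'E] := @finite_dependent s (B s) finu.
  pose M := (\max_(x <- s' ++ s) x)%N.
  have ltM x : x \in s' ++ s -> (x < M.+1)%N.
    by move=> xs; rewrite ltnS; exact: (bigmaxn_sup_seq x).
  exists M.+1; split => [|m ms]; last by apply: ltM; rewrite mem_cat ms orbT.
  rewrite /bad s'E /= => Ms'; have := ltM M.+1.
  by rewrite mem_cat Ms' ltnn => /(_ isT).
pose hist := fix hist k := if k is k'.+1 then rcons (hist k') (F (hist k')) else [::].
pose g k := F (hist k).
have histE k : hist k = mkseq g k.
  by elim: k => // k IH; rewrite mkseqS -IH.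
exists g.
  by move=> k; apply: (FP (hist k.+1)).2; rewrite /= mem_rcons in_cons eqxx.
move=> c N cL; elim: N => // N IH rel m.
have cN0 : c N = 0.
  apply: contrapT => /eqP cN; apply: (FP (hist N)).1.
  have szN : size (hist N) = N by rewrite histE size_mkseq.
  have cB i : (i < N.+1)%N -> (`|c i| <= B (hist N))%N.
    move=> iN; apply: leq_trans (cL i) _; rewrite /B szN.
    exact: (@leq_bigmax _ (fun i : 'I_N.+1 => L i) (Ordinal iN)).
  exists (c N), c; split=> //; first exact: cB.
    by rewrite szN => i iN; apply: cB; apply: ltnW.
  move=> h; rewrite szN addrC -[RHS](rel h) big_ord_recr /=; congr (_ + _).
  by apply: eq_bigr => i _; rewrite histE nth_mkseq.
rewrite ltnS leq_eqVlt => /predU1P[->//|].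
apply: IH => h; have := rel h.
by rewrite big_ord_recr /= cN0 mul0r addr0.
Qed.

End Subsequences.

Definition nb_coef (B : nat -> nat) k := ((2 * B k).+1 ^ k)%N.

(** The starting points of consecutive intervals of [nat].  The [n]-th interval
    has more than [n] times as many elements as there are bounded coefficient
    vectors on all indices before it; the index [0] lies before all of them. *)
Fixpoint block (B : nat -> nat) n : nat :=
  if n is k.+1 then (block B k + k * nb_coef B (block B k)).+1 else 1.

Section Blocks.
Variable B : nat -> nat.
Local Notation bs := (block B).

Lemma block_lt n : (bs n < bs n.+1)%N.
Proof. by rewrite /= ltnS leq_addr. Qed.

Lemma block_mono m n : (m <= n)%N -> (bs m <= bs n)%N.
Proof.
move=> mn; rewrite -(subnKC mn); elim: (n - m)%N => [|k IH]; rewrite ?addn0 //.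
by rewrite addnS (leq_trans IH) // ltnW // block_lt.
Qed.

Lemma block_gt0 n : (0 < bs n)%N.
Proof. exact: leq_trans (block_mono (leq0n n)). Qed.

Lemma block_uniq m n n' : (bs n <= m < bs n.+1)%N -> (bs n' <= m < bs n'.+1)%N -> n = n'.
Proof.
move=> /andP[n1 n2] /andP[n1' n2']; case: (ltngtP n n') => // nn'.
  by have := leq_trans n2 (leq_trans (block_mono nn') n1'); rewrite ltnn.
by have := leq_trans n2' (leq_trans (block_mono nn') n1); rewrite ltnn.
Qed.

Lemma block_ge n : (n < bs n)%N.
Proof. by elim: n => // n IH; apply: leq_trans (block_lt n). Qed.

Lemma block_mem m : (0 < m)%N -> exists n, (bs n <= m < bs n.+1)%N.
Proof.
move=> m0; have ex : exists n, (m < bs n)%N.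
  by exists m; rewrite block_ge.
case: (ex_minnP ex) => -[|n] mn minn; first by move: mn m0; case: (m).
exists n; rewrite mn andbT leqNgt; apply/negP => /minn; rewrite ltnn //.
Qed.

Variables (H : Type) (u : nat -> H -> int) (active : nat -> Prop).

Hypothesis u0 : exists h, u 0%N h != 0.
Hypothesis B_mono : forall m n, (m <= n)%N -> (B m <= B n)%N.
Hypothesis active_dissociated : forall n, active n ->
  forall c : nat -> int, (forall m, `|c m| <= 2 * B m)%N ->
    (forall h, \sum_(bs n <= m < bs n.+1) c m * u m h = 0) ->
    forall m, (bs n <= m < bs n.+1)%N -> c m = 0.

(** Within an active block two bounded combinations that agree have the same
    coefficients.  So each combination of the earlier forms is cancelled by at
    most one combination from the block, and deleting a single index from the
    support of the latter destroys that relation.  Doing so for every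
    coefficient vector on the earlier indices deletes at most [nb_coef] indices
    of the block.  A relation among the remaining forms is then impossible:
    look at the last block that it meets. *)
Lemma dissociated_after_removal : exists A : nat -> Prop,
  [/\ A 0%N,
      forall n, active n ->
        (count (fun m => ~~ `[< A m >]) (index_iota (bs n) (bs n.+1)) <=
         nb_coef B (bs n))%N &
      dissociated (fun m => if `[< A m >] then B m else 0%N) u].
Proof.
pose coefs n := {ffun 'I_(bs n) -> 'I_(2 * B (bs n)).+1}.
pose relation n (d : coefs n) (e : nat -> int) := forall h,
  \sum_(m < bs n) decode d m * u m h + \sum_(bs n <= m < bs n.+1) e m * u m h = 0.
have /choice[rho rhoP] (p : {n & coefs n}) : exists k : nat,
    (exists e, [/\ forall m, (`|e m| <= B m)%N, relation _ (tagged p) e &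
       exists2 m, (bs (tag p) <= m < bs (tag p).+1)%N & e m != 0]) ->
    exists e, [/\ forall m, (`|e m| <= B m)%N, relation _ (tagged p) e,
       (bs (tag p) <= k < bs (tag p).+1)%N & e k != 0].
  have [[e [eB rel [m mI em]]]|noe] := pselect (exists e,
    [/\ forall m, (`|e m| <= B m)%N, relation _ (tagged p) e &
       exists2 m, (bs (tag p) <= m < bs (tag p).+1)%N & e m != 0]).
    by exists m => _; exists e.
  by exists 0%N => /noe.
pose R n := codom (fun d : coefs n => rho (Tagged coefs d)).
pose A m := m = 0%N \/ exists n, [/\ active n, (bs n <= m < bs n.+1)%N & m \notin R n].
exists A; split; first by left.
- move=> n an; rewrite -size_filter.
  have -> : nb_coef B (bs n) = size (R n).
    by rewrite size_codom card_ffun !card_ord.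
  apply: uniq_leq_size; first by rewrite filter_uniq // iota_uniq.
  move=> m; rewrite mem_filter mem_index_iota => /andP[/asboolPn nA mI].
  by apply: contrapT => /negP mR; apply: nA; right; exists n.
move=> c N cB rel m mN; apply: contrapT => /eqP cm0.
pose c' m := if (m < N)%N then c m else 0.
have relc' K h : (N <= K)%N -> \sum_(m < K) c' m * u m h = 0.
  move=> NK; rewrite -[RHS](rel h) (big_ord_widen _ (fun m => c m * u m h) NK).
  rewrite [RHS]big_mkcond; apply: eq_bigr => i _.
  by rewrite /c'; case: ifP => // _; rewrite mul0r.
have c'A k : c' k != 0 -> A k.
  rewrite /c'; case: ifP => // kN ck; have := cB k.
  by case: asboolP => // _; rewrite leqn0 absz_eq0 (negbTE ck).
have c'B k : (`|c' k| <= B k)%N.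
  rewrite /c'; case: ifP => // _; apply: leq_trans (cB k) _.
  by case: ifP.
have [k ck0 kmax] : exists2 k, c' k != 0 & forall j, (k < j)%N -> c' j = 0.
  have ex : exists k, c' k != 0 by exists m; rewrite /c' mN.
  have bd k : c' k != 0 -> (k <= N)%N by rewrite /c'; case: ifP => [/ltnW|].
  case: (ex_maxnP ex bd) => k ck kmax; exists k => // j kj.
  by apply/eqP; apply: contraLR kj => /kmax; rewrite -leqNgt.
have [k0|[n [an kI kR]]] := c'A _ ck0.
  have [h uh] := u0; have := relc' N.+1 h (leqnSn _).
  rewrite big_ord_recl big1 ?addr0 => [|i _]; last by rewrite kmax ?k0 ?mul0r.
  by move/eqP; rewrite mulf_eq0 (negbTE uh) orbF; apply/negP; rewrite k0 in ck0.
have [d dE] : exists d : coefs n, forall m, (m < bs n)%N -> decode d m = c' m.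
  by apply: decode_surj => j jn; apply: leq_trans (c'B j) (B_mono (ltnW jn)).
have reld : relation n d c'.
  move=> h.
  have -> : \sum_(m < bs n) decode d m * u m h = \sum_(0 <= m < bs n) c' m * u m h.
    by rewrite big_mkord; apply: eq_bigr => i _; rewrite dE.
  rewrite -(@big_cat_nat _ _ _ (bs n)) ?(ltnW (block_lt n)) //.
  have [NK|KN] := leqP N (bs n.+1); first by rewrite big_mkord relc'.
  rewrite -[RHS](relc' N h (leqnn _)) -[in RHS](big_mkord xpredT (fun m => c' m * u m h)).
  rewrite [RHS](@big_cat_nat _ _ _ (bs n.+1)) ?(ltnW KN) //.
  rewrite [X in _ = _ + X]big_nat_cond [X in _ = _ + X]big1 ?addr0 //.
  move=> j /andP[/andP[nj _] _].
  by rewrite kmax ?mul0r //; apply: leq_trans nj; case/andP: kI.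
have [|e [eB rele rI er0]] := rhoP (Tagged coefs d).
  by exists c'; split=> //; exists k.
set r := rho _ in rI er0 *.
have c'er : c' r - e r = 0.
  apply: (active_dissociated an (c := fun m => c' m - e m)) rI => [j|h].
    by have := c'B j; have := eB j; lia.
  have E := @addrI _ _ _ _ (etrans (rele h) (esym (reld h))).
  under eq_bigr do rewrite mulrBl.
  by rewrite sumrB; apply/eqP; rewrite subr_eq0; apply/eqP; exact: esym E.
have /c'A : c' r != 0 by move/eqP: c'er; rewrite subr_eq0 => /eqP ->.
case=> [r0|[n' [_ rI' rR]]].
  by move: rI; rewrite r0 leqn0 /= gtn_eqF ?block_gt0.
have E := block_uniq rI' rI; rewrite /= in E; rewrite {}E in rI' rR.
by case/negP: rR; apply: codom_f.
Qed.

End Blocks.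

(** * Terms, their almost disjoint branches, and their ultrafilters *)

(** Formal elements of the monoid.  [Lim f] is a new free generator, meant to
    become a cluster point of the sequence [f]; thus the type is closed under
    taking limits of arbitrary sequences of its own elements. *)
Inductive term := One | Gen | Mul of term & term | Lim of (nat -> term).

HB.instance Definition _ := gen_eqMixin term.
HB.instance Definition _ := gen_choiceMixin term.

(** The class of [t] in the free abelian group on the generators [Gen] and
    [Lim f] is encoded by the function [weight ^~ t]: a relation between classes
    is one that holds for all weights [h] of the generators. *)
Fixpoint weight (h : term -> int) (t : term) : int :=
  match t with
  | One => 0
  | Gen => h Gen
  | Mul s t => weight h s + weight h t
  | Lim f => h (Lim f)
  end.

Definition child (t : term) (n : nat) : term :=
  match t with
  | Mul s t => if n is 0 then s else t
  | Lim f => f n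
  | _ => One
  end.

Definition subterm (t : term) (p : seq nat) : term := foldl child t p.

Definition label (t : term) : nat :=
  match t with One => 0 | Gen => 1 | Mul _ _ => 2 | Lim _ => 3 end.

Lemma label_subterm_inj s t :
  (forall p, label (subterm s p) = label (subterm t p)) -> s = t.
Proof.
elim: s t => [||s1 IH1 s2 IH2|f IH] [||t1 t2|g] eqst //;
  try by have := eqst [::].
  congr Mul; [apply: IH1 => p; exact: (eqst (0%N :: p))|].
  by apply: IH2 => p; exact: (eqst (1%N :: p)).
by congr Lim; apply/funext => n; apply: IH => p; exact: (eqst (n :: p)).
Qed.

Definition leaf t := (label t < 2)%N.

Lemma subterm_leaf t p : leaf t -> leaf (subterm t p).
Proof. by elim: p t => //= n p IH [||s t|f]// _; apply: IH. Qed.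

(** Well-foundedness of terms.  If [t] were a subterm of its child [c], then
    [c], being a child of [t], would be a subterm of a child of [c]. *)
Lemma subterm_child_neq t n p : ~~ leaf t -> subterm (child t n) p <> t.
Proof.
elim: t n p => [||s IHs t IHt|f IH] //= n p _ E.
  wlog : / ~~ leaf (if n is 0 then s else t).
    case: (boolP (leaf _)) => [/(subterm_leaf p)|_]; last exact.
    by rewrite E.
  move: E.
  have : exists m q, rcons p n = m :: q.
    by case: p => [|m q]; [exists n, [::]|exists m, (rcons q n)].
  case=> m [q pq] E nl.
  have := congr1 (child^~ n) E; rewrite /= -/(subterm _ _) -foldl_rcons pq /=.
  by case: n {pq E} nl => [|n] nl; [apply: IHs|apply: IHt].
case: (boolP (leaf (f n))) => [/(subterm_leaf p)|nl]; first by rewrite E.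
have [m [q pq]] : exists m q, rcons p n = m :: q.
  by case: (p) => [|m q]; [exists n, [::]|exists m, (rcons q n)].
have := congr1 (child^~ n) E; rewrite /= -/(subterm _ _) -foldl_rcons pq /=.
exact: IH.
Qed.

Lemma eq_weight h h' t :
  (forall p, h (subterm t p) = h' (subterm t p)) -> weight h t = weight h' t.
Proof.
elim: t => [||s IHs t IHt|f IH] //= hh'; try exact: (hh' [::]).
rewrite IHs ?IHt // => p; [exact: (hh' (1%N :: p))|exact: (hh' (0%N :: p))].
Qed.

Definition path_of (i : nat) : seq nat := odflt [::] (unpickle i).

Lemma path_of_surj p : exists i, path_of i = p.
Proof. by exists (pickle p); rewrite /path_of pickleK. Qed.

(** A term has countably many positions and each carries one of four labels, so
    it is determined by a sequence of numbers. *)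
Definition code t i := label (subterm t (path_of i)).

Lemma code_inj : injective code.
Proof.
move=> s t st; apply: label_subterm_inj => p; have [i <-] := path_of_surj p.
exact: (congr1 (@^~ i) st).
Qed.

(** The finite prefixes of [code t].  Distinct codes share finitely many
    prefixes, so this is an almost disjoint family of sets of integers that is
    indexed by all terms. *)
Definition branch t : set nat := [set pickle (mkseq (code t) k) | k in setT].

Lemma branch_unbounded t N : exists2 n, branch t n & (N <= n)%N.
Proof.
have inj : injective (fun k => pickle (mkseq (code t) k)).
  move=> k l /(pcan_inj (@pickleK _)) /(congr1 size).
  by rewrite !size_mkseq.
apply: contrapT => H.
have lt k : (pickle (mkseq (code t) k) < N)%N.
  rewrite ltnNge; apply/negP => le; apply: H.
  by exists (pickle (mkseq (code t) k)) => //; exists k.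
pose f (k : 'I_N.+1) : 'I_N := Ordinal (lt k).
have /leq_card : injective f by move=> k l [] /inj /val_inj.
by rewrite !card_ord ltnn.
Qed.

Lemma branch_almost_disjoint s t : s <> t ->
  exists N, forall n, branch s n -> branch t n -> (n < N)%N.
Proof.
move=> st; have [i ci] : exists i, code s i <> code t i.
  by apply/existsNP => /funext /code_inj.
exists (\max_(k < i.+1) pickle (mkseq (code s) k)).+1%N.
move=> n [k _ <-] [l _ /(pcan_inj (@pickleK _)) E].
have kl : l = k by rewrite -(size_mkseq (code t) l) E size_mkseq.
have ki : (k < i.+1)%N.
  rewrite ltnS leqNgt; apply/negP => ik; apply: ci.
  by rewrite -(nth_mkseq 0%N (code s) ik) -E nth_mkseq // kl.
rewrite ltnS.
exact: (@leq_bigmax _ (fun k : 'I_i.+1 => pickle (mkseq (code s) k)) (Ordinal ki)).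
Qed.

Section Filters.
Variable B : nat -> nat.

(** The sets that, in all but finitely many of the blocks assigned to [t] by
    [branch t], miss at most a fixed multiple of [nb_coef] elements.  The factor
    [k] makes this a filter; the growth of the blocks makes it proper. *)
Definition large (t : term) : set_system nat :=
  [set E | exists k, forall n, (k <= n)%N -> branch t n ->
     (count (fun m => ~~ `[< E m >]) (index_iota (block B n) (block B n.+1)) <=
      k * nb_coef B (block B n))%N].

Lemma large_proper t : ProperFilter (large t).
Proof.
split.
  move=> [k kP]; have [n tn kn] := branch_unbounded t k.
  have := kP n kn tn; rewrite (eq_count (a2 := xpredT)).
    rewrite count_predT size_iota /= leqNgt subSn ?leq_addr // addKn ltnS.
    by rewrite leq_mul2r kn orbT.
  by move=> m; rewrite asboolF.
split.
- exists 0%N => n _ _; rewrite (eq_count (a2 := pred0)) ?count_pred0 // => m.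
  by rewrite asboolT.
- move=> E F [k kE] [l lF]; exists (k + l)%N => n kln tn.
  have kn := leq_trans (leq_addr _ _) kln; have ln := leq_trans (leq_addl _ _) kln.
  set i := index_iota _ _.
  have le : (count (fun m => ~~ `[< (E `&` F) m >]) i <=
      count (predU (fun m => ~~ `[< E m >]) (fun m => ~~ `[< F m >])) i)%N.
    apply: sub_count => m /=; apply: contraR; rewrite negb_or !negbK.
    by move=> /andP[/asboolP Em /asboolP Fm]; apply/asboolP.
  have := kE n kn tn; have := lF n ln tn; rewrite -/i mulnDl.
  have := count_predUI (fun m => ~~ `[< E m >]) (fun m => ~~ `[< F m >]) i; lia.
move=> E F EF [k kE]; exists k => n kn tn; apply: leq_trans (kE n kn tn).
by apply: sub_count => m; apply: contra => /asboolP /EF Fm; apply/asboolP.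
Qed.

(** The ultrafilter along which [Lim f] is to be the limit of [f], for
    [t = Lim f]. *)
Definition ultra t : set_system nat :=
  projT1 (cid (ultraFilterLemma (large_proper t))).

#[global] Instance ultra_ultra t : UltraFilter (ultra t).
Proof. by rewrite /ultra; case: cid => U []. Qed.

Lemma ultra_large t : large t `<=` ultra t.
Proof. by rewrite /ultra; case: cid => U []. Qed.

Lemma ultra_tail t N : ultra t [set m | (N <= m)%N].
Proof.
apply: ultra_large; exists N => n Nn _.
rewrite (@eq_in_count _ _ pred0) ?count_pred0 // => m.
rewrite mem_index_iota => /andP[nm _]; rewrite asboolT //=.
exact: leq_trans Nn (leq_trans (ltnW (block_ge B n)) nm).
Qed.

End Filters.

(** * Finitely many approximate conditions on a character *)

Section Separation.
Variable T : Type.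

Definition additive_form (x : (T -> int) -> int) :=
  forall (k : int) h h', x (fun t => k * h t + h' t) = k * x h + x h'.

(** If [h] works for the forms treated so far and [h'] for the next one, which
    vanishes at [h], then [K * h + h'] works for all of them once [K] exceeds
    the absolute values of the earlier forms at [h']. *)
Lemma common_witness (X : seq ((T -> int) -> int)) :
  (forall i, (i < size X)%N -> additive_form (nth (fun=> 0) X i)) ->
  exists h, forall i, (i < size X)%N ->
    (exists h', nth (fun=> 0) X i h' != 0) -> nth (fun=> 0) X i h != 0.
Proof.
elim: X => [|x X IH] addX; first by exists (fun=> 0).
have [i iX|h hX] := IH; first exact: (addX i.+1).
have [[h' xh']|nx] := pselect (exists h', x h' != 0); last first.
  by exists h => -[|i] //=; exact: hX.
have [xh0|xh] := eqVneq (x h) 0; last by exists h => -[|i] //=; exact: hX.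
pose K := (\max_(i < size X) absz (nth (fun=> 0%R) X i h')).+1%N.
exists (fun t => K%:Z * h t + h' t) => -[|i] /=.
  by move=> _ _; have /= -> := addX 0%N isT K%:Z h h'; rewrite xh0 mulr0 add0r.
rewrite ltnS => iX /(hX i iX) nz; have /= -> := addX i.+1 iX K%:Z h h'.
have : (absz (nth (fun=> 0%R) X i h') < K)%N.
  pose b (j : 'I_(size X)) := absz (nth (fun=> 0%R) X j h').
  by rewrite ltnS; exact: (@leq_bigmax _ b (Ordinal iX)).
move: nz; set a := nth _ _ _ h; set b := nth _ _ _ h'; move: K a b => K a b.
nia.
Qed.

End Separation.

(** Exponential growth lets the errors allowed at the index [m] tend to [0]
    while the sum in the hypothesis of [kronecker_approximation] stays below
    [1]. *)
Definition coef_bound m := (64 * 8 ^ m)%N.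

Lemma coef_bound_mono m n : (m <= n)%N -> (coef_bound m <= coef_bound n)%N.
Proof. by move=> mn; rewrite leq_mul2l leq_exp2l. Qed.

Section Characters.
Variable C : numClosedFieldType.

Definition unitary_hom (chi : term -> C) :=
  [/\ forall t, `|chi t| = 1, chi One = 1 &
      forall s t, chi (Mul s t) = chi s * chi t].

(** The [i]-th summand is [2 ^ - (i + 1)]. *)
Lemma geometric_bound (A : nat -> bool) N :
  \sum_(i < N | A i) 2 * (4 * 2 ^+ i) ^+ 2 / (coef_bound i)%:R < 1 :> C.
Proof.
have bd : \sum_(i < N) 2 * (4 * 2 ^+ i) ^+ 2 / (coef_bound i)%:R = 1 - 2 ^- N :> C.
  elim: N => [|N IH]; first by rewrite big_ord0 expr0 invr1 subrr.
  rewrite big_ord_recr /= IH /coef_bound natrM natrX.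
  have -> : (8%:R : C) = 2 ^+ 3 by rewrite -natrX.
  rewrite -exprM mulnC exprM.
  have : (2 : C) ^+ N != 0 by rewrite expf_neq0 ?pnatr_eq0.
  rewrite [2 ^+ N.+1]exprS; move: (2 ^+ N) => y y0.
  by field; rewrite y0.
apply: (@le_lt_trans _ _ (1 - 2 ^- N)); last first.
  by rewrite ltrBlDr ltrDl invr_gt0 exprn_gt0.
rewrite -bd [X in X <= _]big_mkcond /=; apply: ler_sum => i _.
case: ifP => // _; rewrite divr_ge0 ?ler0n // mulr_ge0 // exprn_ge0 //.
by rewrite mulr_ge0 // exprn_ge0.
Qed.

(** The first [N] requirements can be met together: choose [h] mapping to
    nonzero integers the finitely many bounded combinations that do not
    vanish, so that the integers [u m h] are still free of small relations,
    and approximate.  The form of index [0] is sent near [-1], all the others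
    near [1]. *)
Lemma finite_character (A : nat -> Prop) (u : nat -> (term -> int) -> int) N :
    (forall m, additive_form (u m)) ->
    dissociated (fun m => if `[< A m >] then coef_bound m else 0%N) u ->
  exists (h : term -> int) (w : C), `|w| = 1 /\
    forall m, (m < N)%N -> A m ->
      4 * 2 ^+ m * `|w ^ u m h - (if m == 0%N then -1 else 1)| < 1.
Proof.
move=> addu dis.
pose L m := if `[< A m >] then coef_bound m else 0%N.
pose T := {ffun 'I_N -> 'I_(2 * coef_bound N).+1}.
pose x (d : T) (h : term -> int) := \sum_(m < N) decode d m * u m h.
have addx d : additive_form (x d).
  move=> k h h'; rewrite /x mulr_sumr -big_split /=; apply: eq_bigr => m _.
  by rewrite addu mulrDr mulrCA.
have [i iX|h hP] := @common_witness term [seq x d | d <- enum T].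
  by rewrite (nth_map [ffun=> ord0]) //; rewrite size_map in iX.
have hx d : (exists h', x d h' != 0) -> x d h != 0.
  have dT : d \in enum T by rewrite mem_enum.
  have szd : (index d (enum T) < size [seq x d | d <- enum T])%N.
    by rewrite size_map index_mem.
  have := hP _ szd.
  by rewrite (nth_map d) ?index_mem // nth_index.
pose tau (i : 'I_N) : C := if i == 0%N :> nat then -1 else 1.
pose lam (i : 'I_N) : C := (4 * 2 ^+ i) ^+ 2.
have lam0 i : 0 <= lam i by rewrite exprn_ge0 // mulr_ge0 // exprn_ge0.
have [||||w w1 wP] := @kronecker_approximation C _
  (fun i : 'I_N => u i h) (fun i => L i) lam tau.
- by move=> i; rewrite /tau; case: eqP; rewrite ?normrN normr1.
- exact: lam0.
- rewrite [X in X < _](_ : _ = \sum_(i < N | (0 < L i)%N)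
      2 * (4 * 2 ^+ i) ^+ 2 / (coef_bound i)%:R).
    exact: (geometric_bound (fun i => (0 < L i)%N)).
  by apply: eq_bigr => i; rewrite /L; case: ifP.
- move=> c cL rel.
  pose c' m := if insub m is Some i then c i else 0.
  have c'L m : (`|c' m| <= L m)%N.
    by rewrite /c'; case: insubP => [i _ <-|//]; apply: cL.
  have c'E (i : 'I_N) : c' i = c i.
    by rewrite /c' insubT //= => lt; congr c; apply: val_inj.
  have [|d dE] := @decode_surj (coef_bound N) N c'.
    move=> m mN; apply: leq_trans (c'L m) _; rewrite /L; case: ifP => // _.
    exact/coef_bound_mono/ltnW.
  have xd h' : x d h' = \sum_(m < N) c' m * u m h'.
    by apply: eq_bigr => m _; rewrite dE.
  move=> i; rewrite -c'E; apply: (dis c' N c'L) (ltn_ord i) => h'.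
  apply: contrapT => /eqP; rewrite -xd => nz.
  have := hx d (ex_intro _ h' nz).
  rewrite xd (eq_bigr (fun i : 'I_N => c i * u i h)) ?rel ?eqxx // => m _.
  by rewrite c'E.
exists h, w; split=> // m mN Am.
pose i := Ordinal mN.
have : (4 * 2 ^+ m * `|w ^ u m h - tau i|) ^+ 2 < 1.
  apply: le_lt_trans wP; rewrite (bigD1 i) /=; last first.
    by rewrite /L asboolT // muln_gt0 expn_gt0.
  rewrite exprMn lerDl; apply: sumr_ge0 => j _.
  by rewrite mulr_ge0 // exprn_ge0.
have ge0 : 0 <= 4 * 2 ^+ m * `|w ^ u m h - tau i|.
  by rewrite mulr_ge0 // mulr_ge0 // exprn_ge0.
by rewrite expr_lt1.
Qed.

End Characters.

(** * Selecting indices without small relations *)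

Definition dissociated_terms (f : nat -> term) :=
  dissociated (fun m => 2 * coef_bound m)%N (fun m h => weight h (f m)).

Section Choosing.
Variables (d : nat -> term) (t0 : term).
Hypothesis t0_nz : exists h, weight h t0 != 0.

(** Given countably many terms, each block gets a single owner: the first term
    of the enumeration whose branch contains the number of the block.  By
    almost disjointness each [Lim f] of the list owns nearly all the blocks
    of its branch. *)
Lemma block_owner : exists F : nat -> nat -> term,
  forall i f, d i = Lim f ->
    exists N, forall n, (N <= n)%N -> branch (Lim f) n -> F n = f.
Proof.
have /choice[F FP] n : exists F : nat -> term, forall i f, branch (d i) n ->
    (forall j, (j < i)%N -> ~ branch (d j) n) -> d i = Lim f -> F = f.
  have [[i [di mini]]|no] := pselect (exists i, branch (d i) n /\
      forall j, (j < i)%N -> ~ branch (d j) n); last first.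
    by exists (fun=> One) => i f di mini _; case: no; exists i.
  have [[f df]|no] := pselect (exists f, d i = Lim f); last first.
    exists (fun=> One) => j f dj minj djf; case: no.
    by case: (ltngtP i j) => [/minj /(_ di)//|/mini /(_ dj)//|->]; exists f.
  exists f => j g dj minj djg.
  have ij : i = j by case: (ltngtP i j) => [/minj /(_ di)//|/mini /(_ dj)//|->].
  by move: djg; rewrite -ij df => -[].
exists F => i f di.
have ex : exists i, `[< d i = Lim f >] by exists i; apply/asboolP.
case: (ex_minnP ex) => {di}i /asboolP di mini.
have /choice[N NP] j : exists N, (j < i)%N ->
    forall n, branch (d j) n -> branch (Lim f) n -> (n < N)%N.
  have [ji|ij] := ltnP j i; last by exists 0%N.
  have [|N NP] := @branch_almost_disjoint (d j) (Lim f); last by exists N.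
  by move=> djf; have := mini j (introT (asboolP _) djf); rewrite leqNgt ji.
exists (\max_(j < i) N j)%N => n Nn fn.
apply: (FP n i) => //; first by rewrite di.
move=> j ji dj; have := leq_trans (NP j ji n dj fn) (leq_trans _ Nn).
by rewrite ltnn => /(_ (@leq_bigmax _ (fun j : 'I_i => N j) (Ordinal ji))).
Qed.

(** By well-foundedness the generator [Lim f] does not occur in [f m]. *)
Lemma weight_upd_lim f m h :
  weight (fun t => if t == Lim f then 0 else h t) (f m) = weight h (f m).
Proof.
apply: eq_weight => p; case: eqP => // E; exfalso.
exact: (@subterm_child_neq (Lim f) m p).
Qed.

Lemma additive_weight t : additive_form (fun h => weight h t).
Proof.
move=> k h h'; elim: t => [||s IHs t IHt|f IH] //=; first by rewrite mulr0 addr0.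
by rewrite IHs IHt mulrDr addrACA.
Qed.

(** The relations to be imposed on a character for the terms [d i]: the form
    of index [0] is [t0], and the form of index [m] in a block owned by [Lim f]
    is the difference between [f m] and [Lim f].  After the removal of few
    indices from each block those that remain, the set [A], are dissociated. *)
Lemma dissociated_selection : exists (F : nat -> nat -> term) (A : nat -> Prop)
    (u : nat -> (term -> int) -> int),
  [/\ A 0%N /\ u 0%N = (fun h => weight h t0),
      forall m, additive_form (u m),
      dissociated (fun m => if `[< A m >] then coef_bound m else 0%N) u,
      forall n m, (block coef_bound n <= m < block coef_bound n.+1)%N ->
        u m = (fun h => weight h (F n m) - h (Lim (F n))) &
      forall i f, d i = Lim f -> dissociated_terms f ->
        exists N, forall n, (N <= n)%N -> branch (Lim f) n -> F n = f /\
        (count (fun m => ~~ `[< A m >])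
           (index_iota (block coef_bound n) (block coef_bound n.+1)) <=
         nb_coef coef_bound (block coef_bound n))%N].
Proof.
have [F FP] := block_owner.
have /choice[blk blkP] m : exists n,
    (0 < m)%N -> (block coef_bound n <= m < block coef_bound n.+1)%N.
  case: m => [|m]; first by exists 0%N.
  by have [n nP] := block_mem coef_bound (ltn0Sn m); exists n.
pose u m h :=
  if m == 0%N then weight h t0 else weight h (F (blk m) m) - h (Lim (F (blk m))).
have uE n m : (block coef_bound n <= m < block coef_bound n.+1)%N ->
    u m = (fun h => weight h (F n m) - h (Lim (F n))).
  move=> nm; have m0 : (0 < m)%N.
    by case/andP: nm => /(leq_trans (block_gt0 coef_bound n)).
  by rewrite /u gtn_eqF // (block_uniq (blkP m m0) nm).
have [|n gn c cB rel m nm|A [A0 Acount Adis]] :=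
    @dissociated_after_removal coef_bound _ u
      (fun n => dissociated_terms (F n)) _ coef_bound_mono.
- by have [h hP] := t0_nz; exists h; rewrite /u eqxx.
- pose c' m := if (block coef_bound n <= m < block coef_bound n.+1)%N then c m else 0.
  have c'm : c' m = c m by rewrite /c' nm.
  have /andP[nm1 nm2] := nm.
  rewrite -c'm; apply: (gn c' (block coef_bound n.+1)) nm2 => [k|h].
    by rewrite /c'; case: ifP => // _; apply: cB.
  (* Weights vanishing on [Lim (F n)] leave a relation between the terms of
     [F n] alone. *)
  rewrite -[RHS](rel (fun t => if t == Lim (F n) then 0 else h t)).
  rewrite -(big_mkord xpredT (fun m => c' m * weight h (F n m))).
  rewrite (@big_cat_nat _ _ _ (block coef_bound n)) ?(ltnW (block_lt _ _)) //=.
  rewrite big_nat big1 ?add0r => [|k /andP[_ kn]]; last first.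
    by rewrite /c' leqNgt kn mul0r.
  apply: eq_big_nat => k kI; rewrite /c' kI (uE n k kI) eqxx subr0.
  by rewrite weight_upd_lim.
exists F, A, u; split=> //.
- move=> m k h h'; rewrite /u; case: eqP => _; first exact: additive_weight.
  by rewrite additive_weight mulrBr addrACA opprD.
move=> i f di gf; have [N NP] := FP i f di.
exists N => n Nn fn; have Fn := NP n Nn fn; split=> //.
by apply: Acount; rewrite Fn.
Qed.
End Choosing.

(** * Characters prescribed on countably many terms *)

Section Limits.
Variable C : numClosedFieldType.

Definition ulim (U : set_system nat) (u : nat -> C) (l : C) :=
  forall e, 0 < e -> U [set m | `|u m - l| < e].

Definition circle_compact := forall U : set_system nat, UltraFilter U ->
  forall u : nat -> C, (forall m, `|u m| = 1) -> exists2 l, `|l| = 1 & ulim U u l.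

Lemma ulim_unique (U : set_system nat) u l l' : ProperFilter U ->
  ulim U u l -> ulim U u l' -> l = l'.
Proof.
move=> UP ul ul'; apply/eqP; rewrite -subr_eq0 -normr_eq0; apply: contraT => nz.
have e0 : 0 < `|l - l'| / 2 by rewrite divr_gt0 // lt_neqAle eq_sym nz normr_ge0.
have [m [/= lm lm']] := filter_ex (filterI (ul _ e0) (ul' _ e0)).
rewrite distrC in lm; have := ltrD lm lm'; rewrite -splitr => lt.
have : `|l - l'| < `|l - l'|.
  by apply: le_lt_trans lt; exact: ler_distD.
by rewrite ltxx.
Qed.

Lemma ulimM (U : set_system nat) u u' l l' : Filter U ->
  (forall m, `|u m| = 1) -> `|l'| = 1 ->
  ulim U u l -> ulim U u' l' -> ulim U (fun m => u m * u' m) (l * l').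
Proof.
move=> UF u1 l1 ul ul' e e0; have e20 : 0 < e / 2 by rewrite divr_gt0.
apply: filterS (filterI (ul _ e20) (ul' _ e20)) => m [/= um um'].
rewrite [X in _ < X]splitr.
apply: le_lt_trans (ler_distD (u m * l') _ _) _.
by rewrite -mulrBr -mulrBl !normrM u1 l1 mul1r mulr1 addrC ltrD.
Qed.

Hypothesis compactC : circle_compact.
Hypothesis archiC : forall e : C, 0 < e -> exists n : nat, e^-1 < n%:R.

Lemma unitary_hom_limit (U : set_system nat) (chi : nat -> term -> C) :
  UltraFilter U -> (forall N, unitary_hom (chi N)) ->
  exists2 x, unitary_hom x & forall t, ulim U (chi ^~ t) (x t).
Proof.
move=> UU chiP.
have /choice[x xP] t : exists l, `|l| = 1 /\ ulim U (chi ^~ t) l.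
  have [|l l1 ul] := compactC UU (u := chi ^~ t); last by exists l.
  by move=> N; have [] := chiP N.
exists x; last by move=> t; have [] := xP t.
split=> [t||s t]; first by have [] := xP t.
  apply: (ulim_unique _ (xP One).2) => e e0.
  rewrite (_ : [set m | _] = setT); first exact: filterT.
  by apply/seteqP; split=> m //= _; have [_ -> _] := chiP m; rewrite subrr normr0.
have chi1 m r : `|chi m r| = 1 by have [] := chiP m.
apply: (ulim_unique _ (xP _).2) => e e0.
apply: filterS (ulimM _ (chi1^~ s) (xP t).1 (xP s).2 (xP t).2 e0) => m /=.
by have [_ _ ->] := chiP m.
Qed.

(** Countably many convergence requirements are compatible with [x t0 != 1]:
    take a limit, along any free ultrafilter, of characters that satisfy the
    first [N] relations approximately.  For [Lim f] in the list the set of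
    good indices is large by construction, so convergence holds along its
    ultrafilter. *)
Lemma character_on_countable (t0 : term) (d : nat -> term) :
  (exists h, weight h t0 != 0) ->
  exists x : term -> C, [/\ unitary_hom x, x t0 != 1 &
    forall i f, d i = Lim f -> dissociated_terms f ->
      ulim (ultra coef_bound (Lim f)) (x \o f) (x (Lim f))].
Proof.
move=> t0nz.
have [F [A [u [[A0 u0] addu dis uE FP]]]] := @dissociated_selection d t0 t0nz.
have /choice[h /choice[w hwP]] N := finite_character C N addu dis.
pose chi N t := w N ^ weight (h N) t.
have w1 N : `|w N| = 1 by have [] := hwP N.
have chiP N : unitary_hom (chi N).
  split=> [t||s t]; rewrite /chi ?norm1_exprz //=.
  by rewrite expfzDr // norm1_neq0.
have Utail := @ultra_tail coef_bound One.
have [x xP xlim] := unitary_hom_limit (ultra_ultra coef_bound One) chiP.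
exists x; split=> //.
  (* The limit stays close to the value [-1] prescribed at the index [0]. *)
  have e0 : 0 < 4^-1 :> C by rewrite invr_gt0.
  have [N [/= lt N1]] := filter_ex (filterI (xlim t0 _ e0) (Utail 1%N)).
  have := (hwP N).2 0%N N1 A0; rewrite u0 eqxx expr0 mulr1 -/(chi N t0).
  rewrite mulrC -ltr_pdivlMr // mul1r => lt4; apply/eqP => x1; rewrite x1 distrC in lt.
  have := le_lt_trans (ler_distD (chi N t0) 1 (-1)) (ltrD lt lt4).
  rewrite opprK -[1 + 1]/(2%:R) normr_nat.
  have -> : 4^-1 + 4^-1 = 2^-1 :> C by field.
  move=> lt2; have : 2 < 1 :> C.
    by apply: lt_le_trans lt2 _; rewrite invf_le1 ?ler1n.
  by rewrite (ltr_nat C 2 1).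
move=> i f di gf e e0; apply: ultra_large.
have [N NP] := FP i f di gf.
have [k ke] := archiC e0.
exists (maxn N k).+1 => n nN fn.
have [Fn cnt] := NP n (leq_trans (leq_maxl _ _) (ltnW nN)) fn.
apply: (@leq_trans (nb_coef coef_bound (block coef_bound n))); last by rewrite leq_pmull.
apply: leq_trans cnt; rewrite -!size_filter.
apply: uniq_leq_size => [|m]; first by rewrite filter_uniq ?iota_uniq.
rewrite !mem_filter mem_index_iota => /andP[nE nm]; rewrite nm andbT.
apply: contra nE => /asboolP Am; apply/asboolP => /=.
pose delta : C := (4 * 2 ^+ m)^-1.
have pos : 0 < 4 * 2 ^+ m :> C by rewrite mulr_gt0 ?exprn_gt0.
have delta0 : 0 < delta by rewrite invr_gt0.
have [M [[/= ltm ltL] mM]] := filter_ex (filterI (filterI (xlim (f m) _ delta0)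
  (xlim (Lim f) _ delta0)) (Utail m.+1)).
have m0 : (0 < m)%N by case/andP: nm => /(leq_trans (block_gt0 coef_bound n)).
have := (hwP M).2 m mM Am; rewrite (uE n m nm) gtn_eqF // Fn.
rewrite mulrC -ltr_pdivlMr // mul1r -/delta => ltu.
have ltchi : `|chi M (f m) - chi M (Lim f)| < delta.
  rewrite -[X in X < _]mulr1 -(norm1_exprz (- h M (Lim f)) (w1 M)) -normrM.
  by rewrite mulrBl /chi -!expfzDr ?norm1_neq0 // subrr expr0z.
apply: le_lt_trans (ler_distD (chi M (f m)) _ _) _; rewrite distrC.
have := ltrD ltm (le_lt_trans (ler_distD (chi M (Lim f)) _ _) (ltrD ltchi ltL)).
move/lt_trans; apply.
have -> : delta + (delta + delta) = 3 * delta by ring.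
have em : e^-1 < 2 ^+ m.
  apply: lt_trans ke _; rewrite -natrX ltr_nat.
  apply: leq_ltn_trans (ltn_expl m (isT : 1 < 2)%N).
  apply: leq_trans (leq_maxr N k) (leq_trans (ltnW nN) _).
  by case/andP: nm => + _; apply/leq_trans/ltnW/block_ge.
rewrite /delta invfM mulrA.
have : (2 ^+ m)^-1 < e by rewrite -[e]invrK ltf_pV2 ?posrE ?invr_gt0 ?exprn_gt0.
apply: le_lt_trans; rewrite ger_pMl ?invr_gt0 ?exprn_gt0 //.
by rewrite ler_pdivrMr // mul1r ler_nat.
Qed.

End Limits.

(** * Admissible characters separate terms from the unit *)

Section Admissible.
Variable C : numClosedFieldType.

Definition admissible (phi : term -> C) := unitary_hom phi /\
  forall f, dissociated_terms f ->
    ulim (ultra coef_bound (Lim f)) (phi \o f) (phi (Lim f)).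

Fixpoint generators (t : term) : seq term :=
  match t with
  | One => [::]
  | Mul s t => generators s ++ generators t
  | _ => [:: t]
  end.

Lemma unitary_hom_generators phi t : @unitary_hom C phi ->
  phi t = \prod_(g <- generators t) phi g.
Proof.
move=> [_ phi1 phiM]; elim: t => [||s IHs t IHt|f _] /=; rewrite ?big_nil ?big_seq1 //.
by rewrite big_cat phiM IHs IHt.
Qed.

Lemma weight_generators h t : weight h t = \sum_(g <- generators t) h g.
Proof.
elim: t => [||s IHs t IHt|f _] /=; rewrite ?big_nil ?big_seq1 //.
by rewrite big_cat IHs IHt.
Qed.

(** Weights that are indicators of a generator count its occurrences, so terms
    with the same weights have the same generators up to order. *)
Lemma unitary_hom_weight phi s t : @unitary_hom C phi ->
  (forall h, weight h s = weight h t) -> phi s = phi t.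
Proof.
move=> phiP st; rewrite !(unitary_hom_generators _ phiP); apply: perm_big.
apply/allP => g _ /=; apply/eqP.
have := st (fun t => (t == g)%:Z); rewrite !weight_generators.
have cnt r : \sum_(t <- r) (t == g)%:Z = (count_mem g r)%:Z.
  elim: r => [|t' r IH]; first by rewrite big_nil.
  by rewrite big_cons IH /= PoszD.
by rewrite !cnt => -[].
Qed.

Hypothesis compactC : circle_compact C.
Hypothesis archiC : forall e : C, 0 < e -> exists n : nat, e^-1 < n%:R.

Definition ultralimit (U : set_system nat) (u : nat -> C) : C :=
  xget 1 [set l | `|l| = 1 /\ ulim U u l].

Lemma ultralimitP (U : set_system nat) (u : nat -> C) :
  UltraFilter U -> (forall m, `|u m| = 1) ->
  `|ultralimit U u| = 1 /\ ulim U u (ultralimit U u).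
Proof.
move=> UU u1; rewrite /ultralimit; apply: (@xgetPex _ 1 [set l | `|l| = 1 /\ ulim U u l]).
by have [l l1 ul] := compactC UU u1; exists l.
Qed.

(** The limit terms outside [D] are free generators, so their values may be
    chosen by recursion, as the limits that compactness provides. *)
Fixpoint extend (D : set term) (x : term -> C) (t : term) : C :=
  match t with
  | One => 1
  | Gen => x Gen
  | Mul s t => extend D x s * extend D x t
  | Lim f => if `[< D (Lim f) >] then x (Lim f)
             else ultralimit (ultra coef_bound (Lim f)) (fun m => extend D x (f m))
  end.

Lemma extend_id D x t : unitary_hom x ->
  (forall s n, D s -> D (child s n)) -> D t -> extend D x t = x t.
Proof.
move=> [_ x1 xM] Dch; elim: t => [||s IHs t IHt|f _] //= Dt.
  by rewrite IHs ?IHt -?xM //; [exact: (Dch _ 1%N Dt)|exact: (Dch _ 0%N Dt)].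
by rewrite asboolT.
Qed.

Lemma extend_unitary D x : unitary_hom x -> unitary_hom (extend D x).
Proof.
move=> [x1 _ _]; split=> //; elim=> [||s IHs t IHt|f IH] /=; rewrite ?normr1 //.
  by rewrite normrM IHs IHt mulr1.
case: ifP => // _.
by have [] := @ultralimitP (ultra coef_bound (Lim f)) _ (ultra_ultra _ _) IH.
Qed.

(** Only the countably many subterms of [t0] need care, and they form a set
    closed under children, on which [extend] changes nothing. *)
Lemma admissible_separates (t0 : term) : (exists h, weight h t0 != 0) ->
  exists2 phi, admissible phi & phi t0 != 1.
Proof.
move=> t0nz; pose d i := subterm t0 (path_of i).
have [x [xP xt0 xlim]] := character_on_countable compactC archiC d t0nz.
pose D : set term := range d.
have Dch s n : D s -> D (child s n).
  move=> [i _ <-]; have [j jE] := path_of_surj (rcons (path_of i) n).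
  by exists j => //; rewrite /d jE /subterm foldl_rcons.
have Dt0 : D t0 by have [i iE] := path_of_surj [::]; exists i; rewrite // /d iE.
exists (extend D x); last by rewrite (extend_id xP Dch Dt0).
split=> [|f gf]; first exact: extend_unitary.
have [Df|nDf] := pselect (D (Lim f)).
  have [i _ di] := Df.
  rewrite (extend_id xP Dch Df).
  rewrite (_ : _ \o f = x \o f); first exact: (xlim i).
  by apply/funext => m; rewrite /= (extend_id xP Dch) //; exact: (Dch _ m Df).
rewrite /= asboolF //.
have [e1 _ _] := extend_unitary D xP.
by have [_] := @ultralimitP (ultra coef_bound (Lim f)) _ (ultra_ultra _ _)
  (fun m => e1 (f m)).
Qed.

End Admissible.

(** * Compactness of the complex circle *)

Section Circle.
Import numFieldNormedType.Exports.
Variable R : realType.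

(** A cluster point of the image of an ultrafilter is a limit along it. *)
Lemma bounded_ultra_limit (U : set_system nat) (u : nat -> R) : UltraFilter U ->
  (forall m, `|u m| <= 1) ->
  exists l, forall e, 0 < e -> U [set m | `|u m - l| < e].
Proof.
move=> UU u1; have := @segment_compact R (-1) 1.
move=> /(_ (fmap u U) _) [|l [_ cl]].
  by rewrite /fmap /=; apply: filterS filterT => m _ /=; rewrite in_itv /= -ler_norml.
exists l => e e0.
have [//|nU] := in_ultra_setVsetC [set m | `|u m - l| < e] UU.
have im : fmap u U (u @` (~` [set m | `|u m - l| < e])).
  by rewrite /fmap /=; apply: filterS nU => m nm; exists m.
have [y [[m /= nm <-]]] := cl _ _ im (nbhsx_ballx l e e0).
by rewrite /ball /= distrC => /nm.
Qed.

Lemma circle_compact_complex : circle_compact R[i].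
Proof.
move=> U UU u u1.
have u1' m : complex.Re (u m) ^+ 2 + complex.Im (u m) ^+ 2 = 1.
  by have := add_Re2_Im2 (u m); rewrite u1 expr1n => -[].
have bound (a b : R) : a ^+ 2 + b ^+ 2 = 1 -> `|a| <= 1.
  move=> ab; rewrite -(@expr_le1 _ 2) // real_normK ?num_real // -ab lerDl.
  exact: sqr_ge0.
have [|a aP] := @bounded_ultra_limit U (fun m => complex.Re (u m)) UU.
  by move=> m; apply: bound (u1' m).
have [|b bP] := @bounded_ultra_limit U (fun m => complex.Im (u m)) UU.
  by move=> m; apply: (@bound _ (complex.Re (u m))); rewrite addrC.
have lim : ulim U u (a +i* b)%C.
  move=> e e0.
  have [e' eE] : exists e', e = e'%:C%C.
    exists (complex.Re e); rewrite RRe_real //; exact: gtr0_real.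
  rewrite eE in e0 *; rewrite ltcR in e0.
  have e20 : 0 < e' / 2 by rewrite divr_gt0.
  apply: filterS (filterI (aP _ e20) (bP _ e20)) => m [/= am bm].
  have -> : u m - (a +i* b)%C =
      (complex.Re (u m) - a)%:C%C + 'i%C * (complex.Im (u m) - b)%:C%C.
    by case: (u m) => x y; simpc.
  apply: le_lt_trans (ler_normD _ _) _.
  rewrite normrM !normc_def /= !expr0n !expr1n !addr0 add0r !sqrtr_sqr sqrtr1 mul1r.
  by rewrite -rmorphD ltcR [X in _ < X]splitr ltrD.
exists (a +i* b)%C => //.
set l := (_ +i* _)%C in lim *.
apply/eqP; rewrite -subr_eq0 -normr_eq0; apply: contraT => nz.
have e0 : 0 < Num.norm (`|l| - 1) by rewrite lt_neqAle eq_sym nz normr_ge0.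
have [m /=] := filter_ex (lim _ e0); rewrite -(u1 m) distrC.
by move/(le_lt_trans (ler_dist_dist _ _)); rewrite ltxx.
Qed.

Lemma complex_archimedean (e : R[i]) : 0 < e -> exists n : nat, e^-1 < n%:R.
Proof.
move=> e0; have [r rE] : exists r, e^-1 = r%:C%C.
  by exists (complex.Re e^-1); rewrite RRe_real // gtr0_real // invr_gt0.
exists (Num.truncn r).+1; rewrite rE -(rmorph_nat (real_complex R)) ltcR.
exact: truncnS_gt.
Qed.
End Circle.

(** * Powers of the circle as topological groups *)

Section Torus.
Variables (C : numClosedFieldType) (J : choiceType).

Record torus := Torus {
  coord :> J -> C;
  coord_norm : forall j, `|coord j| = 1 }.

HB.instance Definition _ := gen_eqMixin torus.
HB.instance Definition _ := gen_choiceMixin torus.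

Lemma torusP (x y : torus) : (forall j, x j = y j) -> x = y.
Proof.
case: x y => [x x1] [y y1] /= /funext xy; move: y1; rewrite -xy => y1.
by congr Torus; exact: Prop_irrelevance.
Qed.

Definition torus_one := Torus (fun=> normr1 C).

Fact torus_mul_subproof (x y : torus) j : `|x j * y j| = 1.
Proof. by rewrite normrM !coord_norm mulr1. Qed.
Definition torus_mul (x y : torus) := Torus (torus_mul_subproof x y).

Fact torus_inv_subproof (x : torus) j : `|(x j)^-1| = 1.
Proof. by rewrite normfV coord_norm invr1. Qed.
Definition torus_inv (x : torus) := Torus (torus_inv_subproof x).

Lemma torus_neq0 (x : torus) j : x j != 0.
Proof. exact: norm1_neq0 (coord_norm x j). Qed.

Lemma torus_mulA : associative torus_mul.
Proof. by move=> x y z; apply: torusP => j /=; rewrite mulrA. Qed.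
Lemma torus_mul1 : left_id torus_one torus_mul.
Proof. by move=> x; apply: torusP => j /=; rewrite mul1r. Qed.
Lemma torus_mulr1 : right_id torus_one torus_mul.
Proof. by move=> x; apply: torusP => j /=; rewrite mulr1. Qed.
Lemma torus_mulV : left_inverse torus_one torus_inv torus_mul.
Proof. by move=> x; apply: torusP => j /=; rewrite mulVf ?torus_neq0. Qed.
Lemma torus_mulrV : right_inverse torus_one torus_inv torus_mul.
Proof. by move=> x; apply: torusP => j /=; rewrite mulfV ?torus_neq0. Qed.

HB.instance Definition _ := isGroup.Build torus
  torus_mulA torus_mul1 torus_mulr1 torus_mulV torus_mulrV.

(** The basic neighbourhoods of the topology of pointwise convergence. *)
Definition torus_box (x : torus) (s : seq J) (e : C) : set torus :=
  [set y | forall j, j \in s -> `|x j - y j| < e].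

Definition torus_nbhs (x : torus) : set_system torus :=
  [set U | exists s e, 0 < e /\ torus_box x s e `<=` U].

HB.instance Definition _ := hasNbhs.Build torus torus_nbhs.

Lemma min_gt0 (e e' : C) : 0 < e -> 0 < e' ->
  exists d, [/\ 0 < d, d <= e & d <= e'].
Proof.
move=> e0 e0'; have /orP[le|le] : (e <= e') || (e' <= e).
  by rewrite real_leVge ?gtr0_real.
  by exists e.
by exists e'.
Qed.

Lemma torus_nbhs_filter (x : torus) : ProperFilter (nbhs x).
Proof.
split.
  move=> [s [e [e0 sub]]]; apply: (sub x) => j _.
  by rewrite subrr normr0.
split.
- by exists [::], 1; split.
- move=> U V [s [e [e0 sU]]] [t [e' [e0' tV]]].
  have [d [d0 de de']] := min_gt0 e0 e0'.
  exists (s ++ t), d; split=> // y yst; split.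
    by apply: sU => j js; apply: lt_le_trans de; apply: yst; rewrite mem_cat js.
  by apply: tV => j jt; apply: lt_le_trans de'; apply: yst; rewrite mem_cat jt orbT.
- by move=> U V UV [s [e [e0 sU]]]; exists s, e; split=> // y /sU /UV.
Qed.

Lemma torus_nbhs_singleton (x : torus) (U : set torus) : nbhs x U -> U x.
Proof. by move=> [s [e [e0 sU]]]; apply: sU => j _; rewrite subrr normr0. Qed.

Lemma torus_nbhs_nbhs (x : torus) (U : set torus) : nbhs x U -> nbhs x (nbhs^~ U).
Proof.
move=> [s [e [e0 sU]]]; have e20 : 0 < e / 2 by rewrite divr_gt0.
exists s, (e / 2); split=> // y xy; exists s, (e / 2); split=> // z yz.
apply: sU => j js; rewrite [e]splitr; apply: le_lt_trans (ler_distD (y j) _ _) _.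
by rewrite ltrD ?xy ?yz.
Qed.

HB.instance Definition _ := Nbhs_isNbhsTopological.Build torus
  torus_nbhs_filter torus_nbhs_singleton torus_nbhs_nbhs.

Lemma torus_mulg_continuous :
  continuous (fun x : torus * torus => (x.1 * x.2)%g).
Proof.
move=> [x y] U [s [e [e0 sU]]]; have e20 : 0 < e / 2 by rewrite divr_gt0.
exists (torus_box x s (e / 2), torus_box y s (e / 2)).
  by split; exists s, (e / 2); split=> // z.
move=> [x' y'] [/= xx' yy']; apply: sU => j js /=.
rewrite [e]splitr; apply: le_lt_trans (ler_distD (x j * y' j) _ _) _.
rewrite -mulrBr -mulrBl !normrM !coord_norm mul1r mulr1.
by rewrite addrC ltrD ?xx' ?yy'.
Qed.

HB.instance Definition _ :=
  PreTopologicalMonoid_isTopologicalMonoid.Build torus torus_mulg_continuous.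

Lemma torus_invg_continuous : continuous (fun x : torus => (x^-1)%g).
Proof.
move=> x U [s [e [e0 sU]]]; exists s, e; split=> // y xy; apply: sU => j js /=.
by rewrite -!(norm1_conj (coord_norm _ _)) -rmorphB norm_conjC xy.
Qed.

HB.instance Definition _ :=
  TopologicalMonoid_isTopologicalGroup.Build torus torus_invg_continuous.

Lemma torus_hausdorff : hausdorff_space torus.
Proof.
move=> x y cl; apply: torusP => j; apply/eqP; rewrite -subr_eq0 -normr_eq0.
apply: contraT => nz.
have e0 : 0 < `|x j - y j| / 2 by rewrite divr_gt0 // lt_neqAle eq_sym nz normr_ge0.
have nb (z : torus) : nbhs z (torus_box z [:: j] (`|x j - y j| / 2)).
  by exists [:: j], (`|x j - y j| / 2); split=> // w.
have [z [xz yz]] := cl _ _ (nb x) (nb y).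
have := ltrD (xz j (mem_head _ _)) (yz j (mem_head _ _)).
rewrite -splitr [X in _ + X]distrC => /(le_lt_trans (ler_distD (z j) _ _)).
by rewrite ltxx.
Qed.

End Torus.

(** * The countably compact monoid *)

(** Were there no finite subcover, a sequence whose [n]-th point avoids the
    first [n] members of the cover would have a cluster point in none of
    them. *)
Lemma countably_compact_sequences (T : topologicalType) :
  (forall x : nat -> T, exists z : T, forall U : set T, nbhs z U ->
     forall N, exists2 n, (N <= n)%N & U (x n)) ->
  countably_compact T.
Proof.
move=> cluster_pt CC countC openC coverC; apply: contrapT => noD.
have [A0 CA0] : exists A, CC A.
  apply: contrapT => noC; apply: noD; exists set0; split.
  - by [].
  - exact: finite_set0.
  rewrite -coverC; apply/seteqP; split=> [x [U []]|x [U CU _]]; case: noC; by exists U.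
have [f finj] : exists f : set T -> nat, {in CC &, injective f}.
  by have /countable_injP[f] := countC; exists f.
pose g n := xget A0 [set A | CC A /\ f A = n].
have gC n : CC (g n) by rewrite /g; case: xgetP => // A _ [].
have gf A : CC A -> g (f A) = A.
  move=> CA; have [CA' fA'] : CC (g (f A)) /\ f (g (f A)) = f A.
    by rewrite /g; apply: (@xgetPex _ A0 [set B | CC B /\ f B = f A]); exists A.
  by apply: finj; rewrite ?inE.
have /choice[x xP] n : exists x, forall m, (m < n)%N -> ~ g m x.
  apply: contrapT => nox; apply: noD.
  exists (g @` `I_n); split.
  - by move=> _ [m _ <-].
  - exact/finite_image/finite_II.
  apply/seteqP; split=> // y _; apply: contrapT => ny; apply: nox.
  by exists y => m mn gy; apply: ny; exists (g m) => //; exists m.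
have [z zP] := cluster_pt x.
have [A CA Az] : (\bigcup_(U in CC) U) z by rewrite coverC.
have [n fn An] := zP A (open_nbhs_nbhs (conj (openC A CA) Az)) (f A).+1.
by apply: (xP n (f A) fn); rewrite gf.
Qed.

Section Embedding.
Variable R : realType.
Local Notation C := R[i].

Definition character := {phi : term -> C | admissible phi}.
HB.instance Definition _ := gen_eqMixin character.
HB.instance Definition _ := gen_choiceMixin character.

Local Notation G := (torus C character).

Fact eval_subproof t (j : character) : `|sval j t| = 1.
Proof. by have [[]] := proj2_sig j. Qed.
Definition eval t : G := Torus (eval_subproof t).

Lemma eval_one : eval One = 1%g.
Proof. by apply: torusP => j; have [[]] := proj2_sig j. Qed.

Lemma eval_mul s t : eval (Mul s t) = (eval s * eval t)%g.
Proof. by apply: torusP => j; have [[_ _ jM] _] := proj2_sig j; exact: jM. Qed.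

Lemma eval_lim f (U : set G) : dissociated_terms f -> nbhs (eval (Lim f)) U ->
  forall N, exists2 n, (N <= n)%N & U (eval (f n)).
Proof.
move=> gf [s [e [e0 sU]]] N.
suff : ultra coef_bound (Lim f) [set m | (N <= m)%N /\
    forall j, j \in s -> `|eval (Lim f) j - eval (f m) j| < e].
  by move/filter_ex => [n [Nn ns]]; exists n => //; apply: sU.
apply: filterI; first exact: ultra_tail.
elim: s {sU} => [|j s IH]; first by apply: filterS filterT => m.
have := (proj2_sig j).2 f gf e e0.
apply: filterS2 IH => m js jj i; rewrite in_cons => /predU1P[->|]; last exact: js.
by rewrite distrC.
Qed.

(** Either some element recurs infinitely often, or the sequence takes each
    value finitely often and then has a dissociated subsequence, for which a
    limit was built in. *)
Lemma eval_sequence_cluster (t : nat -> term) :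
  exists s : term, forall U : set G, nbhs (eval s) U ->
    forall N, exists2 n, (N <= n)%N & U (eval (t n)).
Proof.
pose u m h := weight h (t m).
have [fin|] := pselect (forall n, finite_set [set m | u m = u n]).
  have [g gincr dis] := dissociated_subsequence (fun m => 2 * coef_bound m)%N fin.
  exists (Lim (t \o g)) => U nU N.
  have [n Nn Un] := eval_lim dis nU N.
  exists (g n) => //; apply: leq_trans Nn _.
  by elim: n {Un} => // n IH; apply: leq_ltn_trans IH (gincr n).
move=> /existsNP[n inf]; exists (t n) => U nU N.
have [m um Nm] : exists2 m, u m = u n & (N <= m)%N.
  apply: contrapT => H; apply: inf.
  apply: (sub_finite_set _ (finite_II N)) => m /= um.
  by rewrite ltnNge; apply/negP => Nm; apply: H; exists m.
exists m => //.
have -> : eval (t m) = eval (t n).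
  apply: torusP => -[phi [phiP _]] /=; apply: unitary_hom_weight phiP _ => h.
  exact: (congr1 (@^~ h) um).
exact: nbhs_singleton nU.
Qed.

(** All generators occur with nonnegative exponents in [Mul Gen t], and [Gen]
    with a positive one: this element is nontrivial in the free abelian group,
    so an admissible character detects it. *)
Lemma eval_no_inverse t : (eval Gen * eval t)%g <> 1%g :> G.
Proof.
rewrite -eval_mul => E.
have w0 s : 0 <= weight (fun=> 1) s.
  by elim: s => [||s IHs t' IHt|f _] //=; rewrite addr_ge0.
have nz : exists h, weight h (Mul Gen t) != 0.
  by exists (fun=> 1); rewrite /= gt_eqF // ltr_pwDl.
have [phi phiP] :=
  admissible_separates (@circle_compact_complex R) (@complex_archimedean R) nz.
have /(congr1 (fun x : G => x (exist _ phi phiP))) /= := E.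
by move=> ->; rewrite eqxx.
Qed.

Local Notation powers := (range (fun n : nat => (eval Gen ^+ n)%g)).

Lemma closure_powersM (x y : G) :
  closure powers x -> closure powers y -> closure powers (x * y)%g.
Proof.
move=> clx cly U /(@mulg_continuous G (x, y)) [[P Q] /= [nP nQ] PQ].
have [_ [[m _ <-] Pm]] := clx P nP; have [_ [[n _ <-] Qn]] := cly Q nQ.
exists (eval Gen ^+ (m + n))%g; split; first by exists (m + n)%N.
by rewrite expgnDr; exact: (PQ (_, _)).
Qed.

(** Intersecting with a closed set keeps countable compactness and makes the
    powers of [eval Gen] dense. *)
Definition witness_set : set G := range eval `&` closure powers.

Fact witness1 : witness_set 1%g.
Proof.
split; first by exists One => //; exact: eval_one.
by apply: subset_closure; exists 0%N.
Qed.

Fact witnessM x y : witness_set x -> witness_set y -> witness_set (x * y)%g.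
Proof.
move=> [[s _ <-] clx] [[t _ <-] cly]; split; last exact: closure_powersM.
by exists (Mul s t) => //; exact: eval_mul.
Qed.

Definition witness : submonoid G := Submonoid witness1 witnessM.

Local Notation M := (submonoid_type witness).

Lemma nbhs_val (x : M) (U : set M) : nbhs x U ->
  exists2 V : set G, nbhs (val x) V & forall y : M, V (val y) -> U y.
Proof.
rewrite nbhsE => -[W [[V oV VW] Wx] WU].
exists V; first by apply: open_nbhs_nbhs; split=> //; move: Wx; rewrite -VW.
by move=> y Vy; apply: WU; rewrite -VW.
Qed.

Lemma val_nbhs (x : M) (V : set G) : nbhs (val x) V -> nbhs x [set y : M | V (val y)].
Proof. exact: (@initial_continuous _ _ (set_val : witness -> G)). Qed.

Lemma witness_hausdorff : hausdorff_space M.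
Proof.
move=> x y cl; apply/val_inj/torus_hausdorff => U V nU nV.
by have [z [Uz Vz]] := cl _ _ (val_nbhs nU) (val_nbhs nV); exists (val z).
Qed.

Lemma witness_valP (x : M) : witness_set (val x).
Proof. exact: set_mem (valP x). Qed.

Lemma witness_sub (x : G) : witness_set x -> exists y : M, val y = x.
Proof. by move=> /mem_set wx; exists (exist _ x wx). Qed.

Lemma witness_countably_compact : countably_compact M.
Proof.
apply: countably_compact_sequences => x.
have /choice[t tE] n : exists t, eval t = val (x n).
  by have [[t _ tE] _] := witness_valP (x n); exists t.
have [s sP] := eval_sequence_cluster t.
have [|z zE] := @witness_sub (eval s).
  split; first by exists s.
  apply: closed_closure => U /sP/(_ 0%N)[n _ Un].
  exists (eval (t n)); split; last exact: Un.
  by rewrite tE; exact: (witness_valP (x n)).2.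
exists z => U /nbhs_val[V]; rewrite zE => /sP Vs VU N.
by have [n Nn Vn] := Vs N; exists n => //; apply: VU; rewrite -tE.
Qed.

Lemma witness_monothetic : monothetic M.
Proof.
have [|a aE] := @witness_sub (eval Gen).
  split; first by exists Gen.
  by apply: subset_closure; exists 1%N.
have powE n : val (a ^+ n)%g = (eval Gen ^+ n)%g.
  exact: etrans (gmulfXn (val : M -> G) n a) (congr1 (fun y : G => (y ^+ n)%g) aE).
exists a; apply/seteqP; split=> // x _ U /nbhs_val[V nV VU].
have [_ [[n _ <-] Vn]] := (witness_valP x).2 V nV.
by exists (a ^+ n)%g; split; [exists n|apply: VU; rewrite powE].
Qed.

Lemma witness_not_group : ~ is_group M.
Proof.
have [|a aE] := @witness_sub (eval Gen).
  split; first by exists Gen.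
  by apply: subset_closure; exists 1%N.
move=> /(_ a)[b [ab _]].
have [[t _ tE] _] := witness_valP b.
apply: (@eval_no_inverse t); rewrite tE -aE.
rewrite -(@monoid.valM _ _ M) ab.
apply: (@monoid.gmulf1 M G (val : M -> G)).
Qed.

End Embedding.

Theorem corollary10p4 :
  exists (G : topologicalGroupType) (S : submonoid G),
    let M : topologicalMonoidType := submonoid_type S in
    [/\ hausdorff_space M, countably_compact M, monothetic M & ~ is_group M].
Proof.
exists (torus Rdefinitions.R[i] (character Rdefinitions.R)), (witness Rdefinitions.R).
split.
- exact: witness_hausdorff.
- exact: witness_countably_compact.
- exact: witness_monothetic.
- exact: witness_not_group.
Qed.
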